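(* Let $G$ be a finite, undirected, simple graph and let $\mathbb{R}$ be a $[0,2]$-factor of $G$. Then $\mathbb{R}$ is maximum (i.e. $T_S(\mathbb{R})\le T_S(\mathbb{R}')$ for every $[0,2]$-factor $\mathbb{R}'$ of $G$) if and only if there is no P-chain with respect to $\mathbb{R}$ in $G$.
   Context: A $[0,2]$-factor of $G$ is a spanning subgraph $\mathbb{R}$ of $G$ with $0\le d_{\mathbb{R}}(x)\le 2$ for all $x\in V(G)$, where $d_{\mathbb{R}}(x)$ is the degree of $x$ in $\mathbb{R}$; its characteristic number is $T_S(\mathbb{R})=\sum_{v\in V(G)}(2-d_{\mathbb{R}}(v))$. A P-chain with respect to $\mathbb{R}$ is a sequence of vertices $x_1,x_2,\dots,x_{k+1}$ of $G$ together with edges $e_i=(x_i,x_{i+1})\in E(G)$, $i=1,\dots,k$, which are pairwise distinct (vertices may repeat), such that: $k$ is odd (the case $k=1$ is allowed); $e_j\in E(G)\setminus E(\mathbb{R})$ for odd $j$ and $e_j\in E(\mathbb{R})$ for even $j$; and either $x_1\ne x_{k+1}$ with $d_{\mathbb{R}}(x_1)\le 1$ and $d_{\mathbb{R}}(x_{k+1})\le 1$, or $x_1=x_{k+1}$ with $d_{\mathbb{R}}(x_1)=0$. *)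

(* Defs.v *)
From mathcomp Require Import all_boot.

Set Implicit Arguments.
Unset Strict Implicit.
Unset Printing Implicit Defensive.

Record sgraph (T : finType) := SGraph {
  adj :> rel T;
  adj_sym : symmetric adj;
  adj_irr : irreflexive adj
}.

(* Subgraphs are taken on the same vertex type, hence are spanning. *)
Definition spanning_subgraph (T : finType) (G R : sgraph T) : Prop :=
  forall x y : T, R x y -> G x y.

Definition deg (T : finType) (R : sgraph T) (x : T) : nat :=
  #|[set y | R x y]|.

Definition factor02 (T : finType) (G R : sgraph T) : Prop :=
  spanning_subgraph G R /\ forall x : T, 0 <= deg R x <= 2.

(* The subtraction does not truncate when R is a [0,2]-factor. *)
Definition TS (T : finType) (R : sgraph T) : nat :=
  \sum_(v : T) (2 - deg R v).

Definition maximum_factor02 (T : finType) (G R : sgraph T) : Prop :=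
  factor02 G R /\ forall R' : sgraph T, factor02 G R' -> TS R <= TS R'.

(* The undirected edge e_i = {x_i, x_(i+1)}. *)
Definition chain_edge (T : finType) (x : nat -> T) (i : nat) : {set T} :=
  [set x i; x i.+1].

(* Only the values x 1, ..., x k.+1 are relevant. *)
Definition P_chain (T : finType) (G R : sgraph T) (k : nat) (x : nat -> T)
    : Prop :=
  [/\ odd k,
      forall i, 1 <= i <= k -> G (x i) (x i.+1),
      forall i j, 1 <= i <= k -> 1 <= j <= k ->
        chain_edge x i = chain_edge x j -> i = j,
      forall j, 1 <= j <= k ->
        if odd j then ~~ R (x j) (x j.+1) else R (x j) (x j.+1)
    & [/\ x 1 <> x k.+1, deg R (x 1) <= 1 & deg R (x k.+1) <= 1]
      \/ (x 1 = x k.+1 /\ deg R (x 1) = 0)].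

(* Main.v *)
Require Import Defs.
From mathcomp Require Import all_boot.
From mathcomp Require Import zify.

Set Implicit Arguments.
Unset Strict Implicit.
Unset Printing Implicit Defensive.

(** Colour an edge blue if it lies outside R and red if it lies in R, and let
    the excess of an edge set at a vertex be its blue degree minus its red
    degree.  Deleting the edges of an alternating trail that starts at [v] with
    a blue edge and ends at [w] lowers the excess by 1 at [v], and by 1 (last
    edge blue) or -1 (last edge red) at [w], and changes nothing elsewhere.

    Switching R along a P-chain therefore raises its degree sum by 2.
    Conversely, if R' has a larger degree sum than R, walk greedily in the
    symmetric difference of R and R' from a vertex of positive excess.  If the
    walk gets stuck after a blue edge, the excess of its last vertex forces a
    P-chain.  If it gets stuck after a red edge, its last vertex has negative
    excess, so deleting the walk preserves the total excess and increases no
    positive excess, and one concludes by induction on the number of edges. *)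

Section EdgeSets.

Variable T : finType.
Implicit Types (G R : sgraph T) (x y : nat -> T) (u v w a b : T).
Implicit Types (C D : {set {set T}}) (e : {set T}).

(** * Graphs as sets of two-element edges *)

Lemma eq_set2 a b v w :
  [set a; b] = [set v; w] -> (a = v /\ b = w) \/ (a = w /\ b = v).
Proof.
move=> /setP E; have := E a; have := E b; have := E v; have := E w.
rewrite !inE !eqxx !orbT (eq_sym v a) /=.
have [->|av] /= := eqVneq a v.
  move=> /orP[] /eqP -> _; last by left.
  by rewrite orbb => /esym/eqP ->; left.
by move=> _ /eqP <- _ /esym/eqP ->; right.
Qed.

Lemma sum_eq1 a : \sum_(u : T) (u == a) = 1.
Proof. by rewrite (bigD1 a) //= eqxx big1 // => u /negPf ->. Qed.

Definition edges R : {set {set T}} :=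
  [set [set p.1; p.2] | p : T * T & R p.1 p.2].

Lemma mem_edges R a b : ([set a; b] \in edges R) = R a b.
Proof.
apply/imsetP/idP => [[[v w]] /=|Rab]; last by exists (a, b); rewrite ?inE.
rewrite inE /= => Rvw /eq_set2[[-> ->]//|[-> ->]].
by rewrite adj_sym.
Qed.

Lemma card_edges R e : e \in edges R -> #|e| = 2.
Proof.
case/imsetP => -[a b] /=; rewrite inE /= => Rab ->.
rewrite cards2; have [ab|//] := eqVneq a b.
by move: Rab; rewrite ab adj_irr.
Qed.

Lemma card2_mem e u : #|e| = 2 -> u \in e -> exists2 v, u != v & e = [set u; v].
Proof.
move=> /eqP/cards2P[a [b [ab ->]]]; rewrite !inE => /orP[] /eqP ->.
  by exists b.
by exists a; rewrite 1?eq_sym // setUC.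
Qed.

Lemma deg_edges R u : deg R u = #|[set e in edges R | u \in e]|.
Proof.
rewrite /deg.
have inj : injective (fun v => [set u; v]).
  by move=> v w /eq_set2[[]|[-> ->]].
rewrite -(card_imset _ inj); apply: eq_card => e; rewrite inE.
apply/imsetP/andP => [[v]|[eR ue]].
  by rewrite inE => Ruv ->; rewrite mem_edges !inE eqxx.
have [v uv ev] := card2_mem (card_edges eR) ue.
by exists v => //; rewrite inE -mem_edges -ev.
Qed.

Definition graph_adj D a b := (a != b) && ([set a; b] \in D).

Lemma graph_adj_sym D : symmetric (graph_adj D).
Proof. by move=> a b; rewrite /graph_adj eq_sym setUC. Qed.

Lemma graph_adj_irr D : irreflexive (graph_adj D).
Proof. by move=> a; rewrite /graph_adj eqxx. Qed.

Definition graph_of D := SGraph (@graph_adj_sym D) (@graph_adj_irr D).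

Lemma edges_graph_of D :
  (forall e, e \in D -> #|e| = 2) -> edges (graph_of D) = D.
Proof.
move=> D2; apply/setP => e; apply/idP/idP => [eG|eD].
  have /eqP/cards2P[a [b [ab E]]] := card_edges eG.
  by move: eG; rewrite E mem_edges /= /graph_adj => /andP[].
have /eqP/cards2P[a [b [ab E]]] := D2 e eD.
by rewrite E mem_edges /= /graph_adj ab -E.
Qed.

(* The elements of [C] are the blue edges: [cdeg C true] is the blue degree and
   [cdeg C false] the red one. *)
Definition cdeg C (c : bool) D u : nat :=
  #|[set e in D | ((e \in C) == c) && (u \in e)]|.

Lemma cdegD1 C c D e u : e \in D ->
  cdeg C c D u = cdeg C c (D :\ e) u + (((e \in C) == c) && (u \in e)).
Proof.
move=> eD; rewrite /cdeg (cardsD1 e) inE eD /= addnC; congr (_ + _).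
by apply: eq_card => f; rewrite !inE andbA.
Qed.

(** * Alternating trails and the excess they remove *)

Fixpoint unused D x k : {set {set T}} :=
  if k is j.+1 then unused D x j :\ chain_edge x j.+1 else D.

Definition alternating C D x k := forall i, i < k ->
  chain_edge x i.+1 \in unused D x i /\ (chain_edge x i.+1 \in C) = ~~ odd i.

Lemma unusedP D x k e :
  reflect (e \in D /\ forall i, 1 <= i <= k -> e <> chain_edge x i)
          (e \in unused D x k).
Proof.
elim: k => [|k IHk] /=.
  by apply: (iffP idP) => [eD|[]//]; split=> // -[].
rewrite !inE; apply: (iffP andP) => [[/eqP ne /IHk[eD h]]|[eD h]].
  split=> // i /andP[i0]; rewrite leq_eqVlt => /orP[/eqP->//|ik].
  by apply: h; rewrite i0.
split; first by apply/eqP/h; rewrite leqnn.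
by apply/IHk; split=> // i /andP[i0 ik]; apply: h; rewrite i0 leqW.
Qed.

Lemma unused_subset D x k : unused D x k \subset D.
Proof. by apply/subsetP => e /unusedP[]. Qed.

Lemma unusedS D1 D2 x k : D1 \subset D2 -> unused D1 x k \subset unused D2 x k.
Proof.
move=> /subsetP s; apply/subsetP => e /unusedP[/s eD h].
by apply/unusedP.
Qed.

Lemma alternatingS C D1 D2 x k :
  D1 \subset D2 -> alternating C D1 x k -> alternating C D2 x k.
Proof.
move=> s h i /h[eD ->]; split=> //.
exact: subsetP (unusedS x i s) _ eD.
Qed.

Lemma eq_unused D x y k : (forall i, i <= k.+1 -> x i = y i) ->
  unused D x k = unused D y k.
Proof.
elim: k => //= k IHk xy; rewrite IHk => [|i ik]; last by rewrite xy // leqW.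
by rewrite /chain_edge !xy.
Qed.

Lemma eq_alternating C D x y k : (forall i, i <= k.+1 -> x i = y i) ->
  alternating C D x k -> alternating C D y k.
Proof.
move=> xy h i ik; have := h i ik.
rewrite (@eq_unused _ _ y) => [|j ji]; last by apply: xy; lia.
by rewrite /chain_edge !xy //; lia.
Qed.

Lemma alternating_edge_inj C D x k : alternating C D x k ->
  forall i j, 1 <= i <= k -> 1 <= j <= k ->
    chain_edge x i = chain_edge x j -> i = j.
Proof.
move=> h.
suff lt_neq i j : 1 <= i -> i < j -> j <= k -> chain_edge x j <> chain_edge x i.
  move=> i j /andP[i0 ik] /andP[j0 jk] E; case: (ltngtP i j) => // lt.
    by case: (lt_neq i j).
  by case: (lt_neq j i).
case: j => // j i0 ij jk; have [/unusedP[_ ne] _] := h j jk.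
by apply: ne; rewrite i0.
Qed.

Lemma mem_set2_nat u a b : a != b -> (u \in [set a; b]) = (u == a) + (u == b) :> nat.
Proof.
by move=> ab; rewrite !inE; case: eqP => //= ->; rewrite (negbTE ab).
Qed.

(** The excess balance, written additively to avoid truncated subtraction. Consecutive edges have
    opposite colours, so their contributions cancel at the vertex they share. *)
Lemma cdeg_unused C D x k u : (forall e, e \in D -> #|e| = 2) ->
  alternating C D x k ->
  cdeg C true (unused D x k) u + cdeg C false D u + (u == x 1)
    + odd k * (u == x k.+1)
  = cdeg C true D u + cdeg C false (unused D x k) u
    + ~~ odd k * (u == x k.+1).
Proof.
move=> D2; elim: k => [|k IHk] h /=; first by lia.
have {}IHk := IHk (fun i ik => h i (leqW ik)).
have [eU eC] := h k (leqnn _).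
have eD : #|chain_edge x k.+1| = 2 by apply: D2; case/unusedP: eU.
have ne : x k.+1 != x k.+2.
  by move: eD; rewrite cards2; case: eqP.
rewrite (cdegD1 C true u eU) (cdegD1 C false u eU) eC in IHk.
have := mem_set2_nat u ne; rewrite -/(chain_edge x k.+1) => E.
move: IHk; case: (odd k) => /=; rewrite E; lia.
Qed.

(** Greedy extension stops because each step uses up an edge; [~~ odd k] is the colour required of
    edge [k.+1]. *)
Lemma maximal_alternating C D v : (forall e, e \in D -> #|e| = 2) ->
  exists k x, [/\ x 1 = v, alternating C D x k
    & cdeg C (~~ odd k) (unused D x k) (x k.+1) = 0].
Proof.
move=> D2.
suff: forall n k x, #|unused D x k| < n -> x 1 = v -> alternating C D x k ->
    exists k x, [/\ x 1 = v, alternating C D x k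
      & cdeg C (~~ odd k) (unused D x k) (x k.+1) = 0].
  by move=> /(_ #|D|.+1 0 (fun=> v)); apply.
elim=> // n IHn k x lt_n x1 h.
case: (posnP (cdeg C (~~ odd k) (unused D x k) (x k.+1))) => [z|].
  by exists k, x.
rewrite card_gt0 => /set0Pn[e]; rewrite !inE => /and3P[eU /eqP eC xe].
have e2 : #|e| = 2 by apply: D2; case/unusedP: eU.
have [w xw Ee] := card2_mem e2 xe.
pose y i := if i <= k.+1 then x i else w.
have xy i : i <= k.+1 -> x i = y i by rewrite /y => ->.
have Ey : chain_edge y k.+1 = e by rewrite /chain_edge /y leqnn ltnn.
have Eu := eq_unused D xy.
apply: (IHn k.+1 y) => //=.
  by rewrite Ey -Eu; move: lt_n; rewrite (cardsD1 e) eU.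
move=> i; rewrite ltnS leq_eqVlt => /orP[/eqP->|]; first by rewrite Ey -Eu.
by move: i; exact: (eq_alternating xy).
Qed.

Lemma augmenting_trail C D : (forall e, e \in D -> #|e| = 2) ->
  \sum_u cdeg C false D u < \sum_u cdeg C true D u ->
  exists k x, [/\ odd k, alternating C D x k
   & forall u, u \in [:: x 1; x k.+1] ->
     cdeg C false D u + (u == x 1) + (u == x k.+1) <= cdeg C true D u].
Proof.
have [n] := ubnP #|D|; elim: n D => // n IHn D lt_n D2 lt_sum.
have [v lt_v] : exists v, cdeg C false D v < cdeg C true D v.
  apply/existsP; apply: contraLR lt_sum; rewrite negb_exists => /forallP le.
  by rewrite -leqNgt; apply: leq_sum => u _; rewrite leqNgt.
have [k [x [x1 h stuck]]] := maximal_alternating C v D2.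
have ex u := cdeg_unused u D2 h.
have [ok|ek] := boolP (odd k).
  move: stuck; rewrite ok /= => stuck.
  exists k, x; split=> // u; have := ex u; rewrite ok /=.
  (* At the last vertex no red edge is left, so the balance gives the bound. At a different first
     vertex, the positive excess of [v] suffices. *)
  have [->|uw] := eqVneq u (x k.+1); first by rewrite stuck; lia.
  by rewrite !inE (negbTE uw) orbF => + /eqP ->; rewrite eqxx x1; lia.
have stuckB : cdeg C true (unused D x k) (x k.+1) = 0 by move: stuck; rewrite ek.
(* An empty walk is not stuck: positive excess at [v] provides a blue edge. *)
have k_gt0 : 0 < k.
  by case: k {h ex ek stuck} stuckB => //=; rewrite x1; lia.
have ltU : #|unused D x k| < n.
  have [eU _] := h 0 k_gt0.
  suff: #|unused D x k| < #|D| by lia.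
  apply: proper_card; apply/properP; split; first exact: unused_subset.
  exists (chain_edge x 1) => //; apply/unusedP => -[_ /(_ 1)].
  by rewrite k_gt0 => /(_ isT).
have U2 e : e \in unused D x k -> #|e| = 2 by move=> /unusedP[/D2].
have sumU : \sum_u cdeg C false (unused D x k) u
          < \sum_u cdeg C true (unused D x k) u.
  have: \sum_u (cdeg C true (unused D x k) u + cdeg C false D u + (u == x 1))
      = \sum_u (cdeg C true D u + cdeg C false (unused D x k) u
                + (u == x k.+1)).
    by apply: eq_bigr => u _; have := ex u; rewrite (negbTE ek) /=; lia.
  by rewrite !big_split /= !sum_eq1; lia.
have [k' [x' [ok' h' end']]] := IHn _ ltU U2 sumU.
exists k', x'; split=> //; first exact: alternatingS (unused_subset _ _ _) h'.
move=> u uE; have := end' u uE; have := ex u; rewrite (negbTE ek) /=.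
(* The vertex [x k.+1] has no blue edge left, so it cannot be an end of the new trail; elsewhere the
   excess in [D] is at least that in the remainder. *)
have [uw|_] := eqVneq u (x k.+1); last by lia.
by rewrite uw stuckB; move: uE; rewrite uw !inE => /orP[]->; lia.
Qed.

(** * Switching along P-chains and comparing two factors *)

Lemma cdeg_false_edges R D u : edges R \subset D ->
  cdeg (~: edges R) false D u = deg R u.
Proof.
move=> /subsetP s; rewrite deg_edges /cdeg; apply: eq_card => e; rewrite !inE.
by case: (boolP (e \in edges R)) => [/s->|_]; rewrite ?andbF.
Qed.

Lemma TS_add_deg G R : factor02 G R -> TS R + \sum_u deg R u = 2 * #|T|.
Proof.
move=> [_ d2]; rewrite -big_split /= mulnC -sum_nat_const.
by apply: eq_bigr => u _; have := d2 u; lia.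
Qed.

Lemma edges_subset G R : spanning_subgraph G R -> edges R \subset edges G.
Proof.
move=> s; apply/subsetP => e /imsetP[[a b]]; rewrite inE /= => Rab ->.
by rewrite mem_edges s.
Qed.

Lemma P_chain_alternating G R k x : P_chain G R k x ->
  alternating (~: edges R) (edges G) x k.
Proof.
case=> _ hG inj hR _ i ik; split.
  apply/unusedP; split; first by rewrite mem_edges hG.
  by move=> j /andP[j0 ji] /inj; lia.
rewrite inE mem_edges; have := hR i.+1; rewrite ik /= => /(_ isT).
by case: (odd i) => /= [->|].
Qed.

Lemma P_chain_switch G R k x : factor02 G R -> P_chain G R k x ->
  exists2 R', factor02 G R' & TS R' < TS R.
Proof.
move=> facR chain; have [sGR d2] := facR.
have alt := P_chain_alternating chain.
pose U := unused (edges G) x k; set C := ~: edges R.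
have sU : U \subset edges G by exact: unused_subset.
(* The switched edge set: blue edges on the chain and red edges off it. *)
pose F := [set e in edges G | (e \in C) == (e \notin U)].
have F2 e : e \in F -> #|e| = 2 by rewrite inE => /andP[/card_edges].
pose R' := graph_of F.
have degR' u : deg R' u + cdeg C true U u
             = cdeg C false U u + cdeg C true (edges G) u.
  rewrite deg_edges edges_graph_of // /cdeg.
  rewrite -(cardsID U [set e in F | u \in e]).
  rewrite -(cardsID U [set e in edges G | _ & _]).
  rewrite -addnA [X in _ + X = _]addnC; congr (_ + (_ + _)); apply: eq_card => e;
  rewrite !inE; have := subsetP sU e;
  case: (e \in U); case: (e \in edges G); case: (e \in edges R);
  by case: (u \in e) => // /(_ isT).
have [ok _ _ _ ends] := chain.
have degE u : deg R' u = deg R u + (u == x 1) + (u == x k.+1).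
  have := cdeg_unused u (@card_edges G) alt; rewrite -/C -/U ok /=.
  by rewrite (cdeg_false_edges u (edges_subset sGR)); have := degR' u; lia.
have facR' : factor02 G R'.
  split=> [a b|u]; first by rewrite /= /graph_adj inE mem_edges => /and3P[].
  rewrite degE /=; have := d2 u.
  case: ends => [[/eqP ne d1 dk]|[E d0]].
    have [->|_] := eqVneq u (x 1); first by rewrite (negbTE ne); lia.
    by have [->|_] := eqVneq u (x k.+1); lia.
  by rewrite -E; have [->|_] := eqVneq u (x 1); lia.
exists R' => //; have := TS_add_deg facR; rewrite -(TS_add_deg facR').
by rewrite (eq_bigr _ (fun u _ => degE u)) !big_split /= !sum_eq1; lia.
Qed.

Lemma smaller_TS_P_chain G R R' : factor02 G R -> factor02 G R' ->
  TS R' < TS R -> exists k x, P_chain G R k x.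
Proof.
move=> facR facR' ltTS; have [sR d2] := facR; have [sR' d2'] := facR'.
pose C := ~: edges R.
pose D := [set e in edges G | (e \in edges R) != (e \in edges R')].
have D2 e : e \in D -> #|e| = 2 by rewrite inE => /andP[/card_edges].
(* Both sides count the edges at [u] in the union of [R] and [R']. *)
have degE u : deg R' u + cdeg C false D u = deg R u + cdeg C true D u.
  have sRR' : edges R :|: edges R' \subset edges G.
    by rewrite subUset !edges_subset.
  rewrite !deg_edges /cdeg.
  rewrite -(cardsID (edges R) [set e in edges R' | u \in e]).
  rewrite -(cardsID (edges R') [set e in edges R | u \in e]).
  rewrite -!addnA; congr (_ + _).
    apply: eq_card => e; rewrite !inE.
    by case: (e \in edges R); rewrite ?andbF // andbT andbC.
  rewrite [RHS]addnC; congr (_ + _); apply: eq_card => e; rewrite !inE;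
  have := subsetP sRR' e; rewrite !inE;
  case: (e \in edges R'); case: (e \in edges G); case: (e \in edges R);
  by case: (u \in e) => // /(_ isT).
have [|k [x [ok alt ends]]] := @augmenting_trail C D D2.
  have: \sum_u (deg R' u + cdeg C false D u) = \sum_u (deg R u + cdeg C true D u).
    exact: eq_bigr.
  have := TS_add_deg facR; rewrite -(TS_add_deg facR') !big_split /=; lia.
exists k, x; split=> //.
- case=> // i ik; have [/unusedP[+ _] _] := alt i ik.
  by rewrite inE mem_edges => /andP[].
- exact: alternating_edge_inj alt.
- case=> // i ik; have [_] := alt i ik.
  by rewrite inE mem_edges /=; case: (odd i) => /= [/negbFE|].
have := ends (x 1); have := ends (x k.+1); rewrite !inE !eqxx orbT.
move=> /(_ isT) e1 /(_ isT) e2.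
(* The excess at [u] is [deg R' u - deg R u], at most [2 - deg R u]. Excess 1 at each of two
   distinct ends gives degree at most 1 in [R]; excess 2 at a common end gives degree 0. *)
have := degE (x 1); have := degE (x k.+1).
have := d2' (x 1); have := d2' (x k.+1).
have [E|ne] := eqVneq (x 1) (x k.+1).
  by right; split=> //; move: e1 e2; rewrite E eqxx; lia.
by left; split; [exact/eqP | lia | lia].
Qed.

End EdgeSets.

Theorem theorem2p2 (T : finType) (G R : sgraph T) (hR : factor02 G R) :
  maximum_factor02 G R <->
  ~ (exists (k : nat) (x : nat -> T), P_chain G R k x).
Proof.
split=> [[_ maxR] [k [x chain]]|nochain].
  have [R' facR'] := P_chain_switch hR chain.
  by rewrite ltnNge maxR.
split=> // R' facR'; rewrite leqNgt; apply/negP => lt.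
exact: nochain (smaller_TS_P_chain hR facR' lt).
Qed.
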